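(* Let $\mathcal{G}$ denote the class of groups isomorphic to countable subgroups of $\mathrm{Homeo}^+(I)$, where $I=[0,1]$. Then $\mathcal{G}$ is closed under countable free products: the free product of any countable family of groups in $\mathcal{G}$ again belongs to $\mathcal{G}$.
   Context: $\mathrm{Homeo}^+(I)$ is the group of orientation preserving homeomorphisms of $I=[0,1]$. *)

(* Defs.v *)
From HB Require Import structures.
From mathcomp Require Import all_boot all_order all_algebra.
From mathcomp Require Import all_classical all_reals all_analysis.

Set Implicit Arguments.
Unset Strict Implicit.
Unset Printing Implicit Defensive.

Import Order.TTheory GRing.Theory Num.Theory.
Import numFieldNormedType.Exports.

Local Open Scope classical_set_scope.
Local Open Scope ring_scope.

Definition homeomorphism (X Y : topologicalType) (f : X -> Y) : Prop :=
  exists g : Y -> X,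
    [/\ cancel f g, cancel g f, continuous f & continuous g].

Section HomeoPlus.
Variable R : realType.

(* [set_type] carries the topology induced from R. *)
Definition unit_interval : Type := set_type (`[0, 1] : set R).

HB.instance Definition _ := Topological.on unit_interval.

Definition unit_increasing (f : unit_interval -> unit_interval) : Prop :=
  forall x y, \val x < \val y -> \val (f x) < \val (f y).

(* A homeomorphism of [0, 1] preserves orientation when it is increasing. *)
Definition orientation_preserving_homeo
    (f : unit_interval -> unit_interval) : bool :=
  `[< homeomorphism f /\ unit_increasing f >].

Record homeoplus := HomeoPlus {
  homeoplus_fun :> unit_interval -> unit_interval;
  _ : orientation_preserving_homeo homeoplus_fun }.

HB.instance Definition _ := [isSub for homeoplus_fun].
HB.instance Definition _ := [Choice of homeoplus by <:].

Implicit Types f g : homeoplus.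

Lemma homeoplusP f : homeomorphism f /\ unit_increasing f.
Proof. exact/asboolP/(valP f). Qed.

Fact homeoplus_one_subproof : orientation_preserving_homeo id.
Proof.
apply/asboolP; split=> //.
by exists id; split=> // x; exact: cvg_id.
Qed.

Fact homeoplus_mul_subproof f g : orientation_preserving_homeo (f \o g).
Proof.
apply/asboolP; have [[f' [fK f'K cf cf']] incf] := homeoplusP f.
have [[g' [gK g'K cg cg']] incg] := homeoplusP g.
split; last by move=> x y /incg/incf.
exists (g' \o f'); split.
- exact: can_comp.
- exact: can_comp.
- by move=> x; apply: continuous_comp; [exact: cg | exact: cf].
- by move=> x; apply: continuous_comp; [exact: cf' | exact: cg'].
Qed.

Fact homeoplus_inv_exists f :
  {g : homeoplus | cancel f g /\ cancel g f}.
Proof.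
apply: cid; have [[f' [fK f'K cf cf']] incf] := homeoplusP f.
have incf' : unit_increasing f'.
  move=> x y xy; rewrite ltNge le_eqVlt; apply/negP => /orP[/eqP/val_inj e|].
    by move: xy; rewrite -(f'K x) -(f'K y) e ltxx.
  by move=> /incf; rewrite !f'K => /(lt_trans xy); rewrite ltxx.
have Hf' : orientation_preserving_homeo f'.
  by apply/asboolP; split=> //; exists f; split.
by exists (HomeoPlus Hf').
Qed.

Definition homeoplus_one : homeoplus := HomeoPlus homeoplus_one_subproof.
Definition homeoplus_mul f g : homeoplus :=
  HomeoPlus (homeoplus_mul_subproof f g).
Definition homeoplus_inv f : homeoplus := sval (homeoplus_inv_exists f).

Fact homeoplus_mulA : associative homeoplus_mul.
Proof. by move=> f g h; apply: val_inj. Qed.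

Fact homeoplus_mul1g : left_id homeoplus_one homeoplus_mul.
Proof. by move=> f; apply: val_inj. Qed.

Fact homeoplus_mulg1 : right_id homeoplus_one homeoplus_mul.
Proof. by move=> f; apply: val_inj. Qed.

Fact homeoplus_mulVg : left_inverse homeoplus_one homeoplus_inv homeoplus_mul.
Proof.
move=> f; apply: val_inj; apply/funext => x /=.
by rewrite /homeoplus_inv; case: homeoplus_inv_exists => g [].
Qed.

Fact homeoplus_mulgV : right_inverse homeoplus_one homeoplus_inv homeoplus_mul.
Proof.
move=> f; apply: val_inj; apply/funext => x /=.
by rewrite /homeoplus_inv; case: homeoplus_inv_exists => g [].
Qed.

HB.instance Definition _ := isGroup.Build homeoplus
  homeoplus_mulA homeoplus_mul1g homeoplus_mulg1
  homeoplus_mulVg homeoplus_mulgV.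

Definition countable_homeoplus_group (G : groupType) : Prop :=
  exists (S : {pred homeoplus}) (f : {multiplicative G -> homeoplus}),
    [/\ group_closed S, countable [set` S] & set_bij [set: G] [set` S] f].

End HomeoPlus.

Section FreeProduct.
Variables (J : Type) (G : J -> groupType).

Local Open Scope group_scope.

Definition fpword : Type := seq {j : J & G j}.

HB.instance Definition _ := gen_eqMixin fpword.
HB.instance Definition _ := gen_choiceMixin fpword.

Definition fpletter (j : J) (x : G j) : {j : J & G j} := existT _ j x.

(* The free product is the quotient of the monoid of words in the disjoint    *)
(* union of the factors by the congruence that deletes trivial letters and    *)
(* multiplies adjacent letters of the same factor.                            *)
Inductive fpequiv : fpword -> fpword -> Prop :=
| FpRefl u : fpequiv u u
| FpSym u v : fpequiv u v -> fpequiv v u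
| FpTrans u v w : fpequiv u v -> fpequiv v w -> fpequiv u w
| FpOne u v j : fpequiv (u ++ fpletter (1 : G j) :: v) (u ++ v)
| FpMul u v j (x y : G j) :
    fpequiv (u ++ fpletter x :: fpletter y :: v) (u ++ fpletter (x * y) :: v).

Definition fprel : rel fpword := fun u v => `[< fpequiv u v >].

Fact fprel_equiv : equiv_class_of fprel.
Proof.
split.
- by move=> u; apply/asboolP; exact: FpRefl.
- by move=> u v; apply/asboolP/asboolP; exact: FpSym.
- by move=> v u w /asboolP uv /asboolP vw; apply/asboolP; exact: FpTrans vw.
Qed.

Canonical fprel_equivRel := EquivRelPack fprel_equiv.

Definition freeprod : Type := {eq_quot fprel_equivRel}%qT.

HB.instance Definition _ := Choice.on freeprod.
HB.instance Definition _ := EqQuotient.on freeprod.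

Definition fpclass (w : fpword) : freeprod := (\pi_freeprod w)%qT.

Lemma fpclassP u v : reflect (fpequiv u v) (fpclass u == fpclass v).
Proof. by rewrite /fpclass piE; exact: asboolP. Qed.

Lemma fpclass_eq u v : fpequiv u v -> fpclass u = fpclass v.
Proof. by move=> /fpclassP/eqP. Qed.

Lemma fpclass_surj (x : freeprod) : exists w, x = fpclass w.
Proof. by exists (repr x); rewrite /fpclass reprK. Qed.

Lemma fpequiv_catl w u v : fpequiv u v -> fpequiv (w ++ u) (w ++ v).
Proof.
elim=> {u v} [u|u v _|u v t _ uv _|u v j|u v j x y].
- exact: FpRefl.
- exact: FpSym.
- exact: FpTrans.
- by rewrite !catA; exact: FpOne.
- by rewrite !catA; exact: FpMul.
Qed.

Lemma fpequiv_catr w u v : fpequiv u v -> fpequiv (u ++ w) (v ++ w).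
Proof.
elim=> {u v} [u|u v _|u v t _ uv _|u v j|u v j x y].
- exact: FpRefl.
- exact: FpSym.
- exact: FpTrans.
- by rewrite -!catA; exact: FpOne.
- by rewrite -!catA; exact: FpMul.
Qed.

Lemma fpequiv_cat u u' v v' :
  fpequiv u u' -> fpequiv v v' -> fpequiv (u ++ v) (u' ++ v').
Proof.
by move=> /(fpequiv_catr v) uu' /(fpequiv_catl u'); exact: FpTrans.
Qed.

Definition fpinv (w : fpword) : fpword :=
  rev [seq fpletter (projT2 l : G (projT1 l))^-1 | l <- w].

Lemma fpinv_cat u v : fpinv (u ++ v) = fpinv v ++ fpinv u.
Proof. by rewrite /fpinv map_cat rev_cat. Qed.

Lemma fpinv_cons l v : fpinv (l :: v) = fpinv v ++ [:: fpletter (projT2 l : G _)^-1].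
Proof. by rewrite /fpinv /= rev_cons cats1. Qed.

Lemma fpequiv_inv u v : fpequiv u v -> fpequiv (fpinv u) (fpinv v).
Proof.
elim=> {u v} [u|u v _|u v t _ uv _|u v j|u v j x y].
- exact: FpRefl.
- exact: FpSym.
- exact: FpTrans.
- by rewrite !fpinv_cat fpinv_cons /= invg1 -catA; exact: FpOne.
- by rewrite !fpinv_cat !fpinv_cons /= invgM -!catA; exact: FpMul.
Qed.

Lemma fpequiv_mulV w : fpequiv (w ++ fpinv w) [::].
Proof.
elim: w => [|[j x] w IH]; first exact: FpRefl.
rewrite fpinv_cons /= catA.
have := fpequiv_catl [:: fpletter x] (fpequiv_catr [:: fpletter x^-1] IH).
move=> /FpTrans; apply; apply: FpTrans (@FpMul [::] [::] j x x^-1) _.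
by rewrite mulgV; exact: (@FpOne [::] [::]).
Qed.

Lemma fpequiv_Vmul w : fpequiv (fpinv w ++ w) [::].
Proof.
elim: w => [|[j x] w IH]; first exact: FpRefl.
rewrite fpinv_cons -catA /=.
apply: FpTrans (@FpMul (fpinv w) w j x^-1 x) _.
by rewrite mulVg; exact: FpTrans (FpOne _ _ _) IH.
Qed.

Definition freeprod_one : freeprod := fpclass [::].
Definition freeprod_mul (x y : freeprod) : freeprod :=
  fpclass (repr x ++ repr y).
Definition freeprod_inv (x : freeprod) : freeprod := fpclass (fpinv (repr x)).

Lemma repr_fpclass w : fpequiv (repr (fpclass w)) w.
Proof. by apply/fpclassP; rewrite /fpclass reprK. Qed.

Lemma freeprod_mulE u v : freeprod_mul (fpclass u) (fpclass v) = fpclass (u ++ v).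
Proof. by apply: fpclass_eq; apply: fpequiv_cat; exact: repr_fpclass. Qed.

Lemma freeprod_invE u : freeprod_inv (fpclass u) = fpclass (fpinv u).
Proof. by apply: fpclass_eq; apply: fpequiv_inv; exact: repr_fpclass. Qed.

Fact freeprod_mulA : associative freeprod_mul.
Proof.
move=> x y z; have [[u ->] [v ->]] := (fpclass_surj x, fpclass_surj y).
by have [w ->] := fpclass_surj z; rewrite !freeprod_mulE catA.
Qed.

Fact freeprod_mul1g : left_id freeprod_one freeprod_mul.
Proof. by move=> x; have [u ->] := fpclass_surj x; rewrite freeprod_mulE. Qed.

Fact freeprod_mulg1 : right_id freeprod_one freeprod_mul.
Proof.
by move=> x; have [u ->] := fpclass_surj x; rewrite freeprod_mulE cats0.
Qed.

Fact freeprod_mulVg : left_inverse freeprod_one freeprod_inv freeprod_mul.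
Proof.
move=> x; have [u ->] := fpclass_surj x; rewrite freeprod_invE freeprod_mulE.
exact/fpclass_eq/fpequiv_Vmul.
Qed.

Fact freeprod_mulgV : right_inverse freeprod_one freeprod_inv freeprod_mul.
Proof.
move=> x; have [u ->] := fpclass_surj x; rewrite freeprod_invE freeprod_mulE.
exact/fpclass_eq/fpequiv_mulV.
Qed.

HB.instance Definition _ := isGroup.Build freeprod
  freeprod_mulA freeprod_mul1g freeprod_mulg1 freeprod_mulVg freeprod_mulgV.

Definition freeprod_inj (j : J) (x : G j) : freeprod := fpclass [:: fpletter x].

Fact freeprod_injM (j : J) : {morph @freeprod_inj j : x y / x * y}.
Proof.
move=> x y; rewrite /freeprod_inj [RHS]freeprod_mulE.
exact/esym/fpclass_eq/(@FpMul [::] [::]).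
Qed.

HB.instance Definition _ (j : J) :=
  isMultiplicative.Build (G j) freeprod (@freeprod_inj j) (@freeprod_injM j).

(* [freeprod] with the maps [freeprod_inj] is the coproduct of the groups G j.*)
Theorem freeprod_universal (H : groupType)
    (f : forall j, {multiplicative G j -> H}) :
  exists! F : freeprod -> H,
    {morph F : x y / x * y} /\ forall j (x : G j), F (freeprod_inj x) = f j x.
Proof.
pose ev (w : fpword) : H := \prod_(l <- w) f (projT1 l) (projT2 l).
have f1 j : f j 1 = 1.
  by apply: (@mulgI _ (f j 1)); rewrite -gmulfM !mulg1.
have evE u v : fpequiv u v -> ev u = ev v.
  elim=> {u v} [u|u v _ ->|u v w _ -> _ ->|u v j|u v j x y] //.
  - by rewrite /ev !big_cat big_cons /= f1 mul1g.
  - by rewrite /ev !big_cat !big_cons /= gmulfM -!mulgA.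
have evr w : ev (repr (fpclass w)) = ev w by exact/evE/repr_fpclass.
exists (ev \o repr); split.
  split=> [x y|j x]; last by rewrite /= evr /ev big_seq1.
  by rewrite /= evr /ev big_cat.
move=> F [FM Ff]; apply/funext => x; have [w ->] := fpclass_surj x.
rewrite /= evr; elim: w {x} => [|[j x] w IH].
  by apply: (@mulgI _ (F 1)); rewrite /ev big_nil mulg1 -FM mulg1.
rewrite /ev big_cons -/(ev w) IH /= -Ff -FM; congr F.
by rewrite [LHS]freeprod_mulE.
Qed.

End FreeProduct.

(* Main.v *)
(* Increasing bijections of the line are homeomorphisms, so it is enough to   *)
(* find increasing actions of the free product on R that are trivial outside  *)
(* [0, 1].  As the free product is countable, one such action for each        *)
(* element z <> 1, moving some point under z, suffices: place them side by    *)
(* side on the intervals [n, n+1) and shrink [0, +oo) to [0, 1).  To get an   *)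
(* action for z, write z as a reduced word and build actions of the factors   *)
(* letter by letter.  Adding to an action its mirror image, every nontrivial  *)
(* element of a factor moves some point up, and a suitable conjugate of that  *)
(* action makes the new letter push the current point beyond all supports     *)
(* used so far.  Consecutive letters lie in different factors, so the new     *)
(* piece does not interfere with the previous motions.                        *)

Require Import Defs.
From HB Require Import structures.
From mathcomp Require Import all_boot all_order all_algebra.
From mathcomp Require Import all_classical all_reals all_analysis.
From mathcomp Require Import ring lra.

Set Implicit Arguments.
Unset Strict Implicit.
Unset Printing Implicit Defensive.

Import Order.TTheory GRing.Theory Num.Theory.
Import numFieldNormedType.Exports.

Local Open Scope classical_set_scope.
Local Open Scope ring_scope.

(** Three lemmas carry the plan above. [homeoplus_line_action] turns an embedding into Homeo+(I)
    into a faithful increasing action on the line with bounded support. [freeprod_separated] gives,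
    for each z other than 1, an action of the free product moving a point under z.
    [countable_homeoplus_separated] merges countably many such actions into one faithful action on
    [0, 1]. The crux is [reduced_word_climbs]: its induction hypothesis asserts the value y of w at
    1 for every family a' agreeing with a on a prescribed region. Hence a further letter may change
    the action outside that region without disturbing the part of the orbit already built. *)

(** * Placing maps side by side and compressing the half-line *)

Section LineMaps.
Variable R : realType.
Implicit Types (f : R -> R) (x : R).

(* The [n]-th map is placed on [n, n+1), and again on [-n, -n+1). *)
Definition spread (a : nat -> R -> R) x : R :=
  (Num.floor x)%:~R + a `|Num.floor x|%N (x - (Num.floor x)%:~R).

(* The conjugate of [f] by the bijection [s |-> s / (1 + s)] from [0, +oo) to *)
(* [0, 1).                                                                    *)
Definition shrink f x : R :=
  if 0 <= x < 1 then f (x / (1 - x)) / (1 + f (x / (1 - x))) else x.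

Lemma shrink_point_itv x : 0 <= x -> 0 <= x / (1 + x) < 1.
Proof. by move=> x0; rewrite divr_ge0//= ?ltr_pdivrMr; lra. Qed.

(** The map [s |-> s / (1 + s)] is injective on [0, +oo), so a fixed point of the compressed map
    comes from a fixed point of [f]. *)
Lemma shrink_fixed f x :
  0 <= x -> 0 <= f x -> shrink f (x / (1 + x)) = x / (1 + x) -> f x = x.
Proof.
move=> x0 fx0; rewrite /shrink shrink_point_itv//.
have -> : x / (1 + x) / (1 - x / (1 + x)) = x by field; lra.
move: (f x) fx0 => y y0 e.
have : y / (1 + y) * (1 + y) * (1 + x) = x / (1 + x) * (1 + x) * (1 + y).
  by rewrite e mulrAC.
by rewrite !divfK; lra.
Qed.

End LineMaps.

(** * Increasing actions on the line and ways to combine them *)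

Section LineActions.
Variables (R : realType) (G : groupType).
Implicit Types (a b : G -> R -> R) (g h : G) (x y c : R).

Record line_action a : Prop := LineAction {
  line_action1 : forall x, a 1%g x = x;
  line_actionM : forall g h x, a (g * h)%g x = a g (a h x);
  line_action_lt : forall g x y, x < y -> a g x < a g y }.

Lemma line_actionKV a g : line_action a -> cancel (a g^-1%g) (a g).
Proof. by move=> aP x; rewrite -line_actionM// mulgV line_action1. Qed.

Lemma line_action_le a g x y : line_action a -> x <= y -> a g x <= a g y.
Proof.
move=> aP; rewrite le_eqVlt => /orP[/eqP -> //|xy].
exact/ltW/line_action_lt.
Qed.

Lemma line_action_conj a (h k : R -> R) :
  cancel h k -> cancel k h ->
  {homo h : x y / x < y} -> {homo k : x y / x < y} ->
  line_action a -> line_action (fun g x => h (a g (k x))).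
Proof.
move=> hK kK hlt klt aP; split=> [x|g1 g2 x|g x y xy].
- by rewrite line_action1.
- by rewrite line_actionM// hK.
- exact/hlt/line_action_lt/klt.
Qed.

Lemma line_action_flip a :
  line_action a -> line_action (fun g x => - a g (- x)).
Proof.
move=> aP; split=> [x|g1 g2 x|g x y xy].
- by rewrite line_action1// opprK.
- by rewrite line_actionM// opprK.
- by rewrite ltrN2 line_action_lt// ltrN2.
Qed.

(** The common fixed point [c] makes both half-lines invariant, so the two pieces never mix. *)
Lemma line_action_glue a b c :
  line_action a -> line_action b ->
  (forall g, a g c = c) -> (forall g, b g c = c) ->
  line_action (fun g x => if x <= c then a g x else b g x).
Proof.
move=> aP bP ac bc.
have ale g x : x <= c -> a g x <= c.
  by move=> xc; rewrite -(ac g) line_action_le.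
have blt g x : c < x -> c < b g x.
  by move=> xc; rewrite -(bc g) line_action_lt.
split=> [x|g1 g2 x|g x y xy].
- by rewrite !line_action1// if_same.
- case: leP => xc; first by rewrite ale// line_actionM.
  by rewrite leNgt blt//= line_actionM.
- case: (leP x c) => xc; case: (leP y c) => yc.
  + exact: line_action_lt.
  + exact: le_lt_trans (ale _ _ xc) (blt _ _ yc).
  + by have := lt_trans xc xy; rewrite ltNge yc.
  + exact: line_action_lt.
Qed.

(* Putting a mirror image on the other side of a fixed point turns points     *)
(* moved down into points moved up.                                           *)
Lemma line_action_up a c :
  line_action a -> (forall g x, x <= 0 -> a g x = x) ->
  (forall g x, c <= x -> a g x = x) ->
  (forall g, g <> 1%g -> exists x, a g x <> x) ->
  exists b, [/\ line_action b, forall g x, c <= `|x| -> b g x = x &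
    forall g, g <> 1%g -> exists x, x < b g x].
Proof.
move=> aP a0 ac af.
exists (fun g x => if x <= 0 then - a g (- x) else a g x); split.
- apply: line_action_glue => //; [exact: line_action_flip| |] => g.
    by rewrite oppr0 a0// oppr0.
  exact: a0.
- move=> g x; case: ifPn => [x0|].
    by rewrite ler0_norm// => /ac ->; rewrite opprK.
  by rewrite -ltNge => x0; rewrite gtr0_norm// => /ac.
- move=> g /af[x /eqP]; rewrite neq_lt => /orP[] axx; last first.
    exists x; case: ifPn => // x0.
    by move: axx; rewrite a0// ltxx.
  have x0 : 0 < x.
    by rewrite ltNge; apply: contraPN axx => x0; rewrite a0// ltxx.
  by exists (- x); rewrite oppr_le0 ltW//= opprK ltrN2.
Qed.

(** Each [a n g] preserves [0, 1), so the floor of a point, and with it the index of the map used,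
    is constant along orbits. *)
Lemma line_action_spread (a : nat -> G -> R -> R) :
  (forall n, line_action (a n)) ->
  (forall n g x, x <= 0 -> a n g x = x) ->
  (forall n g x, 1 <= x -> a n g x = x) ->
  line_action (fun g => spread (a^~ g)).
Proof.
rewrite /spread; move=> aP a0 a1.
have in01 n g x : 0 <= x < 1 -> 0 <= a n g x < 1.
  move=> /andP[/(line_action_le g (aP n)) + /(line_action_lt (aP n) g)].
  by rewrite (a0 n g 0)// (a1 n g 1)// => -> ->.
have fr x : 0 <= x - (Num.floor x)%:~R < 1.
  by have := floor_itv x; rewrite intrD; lra.
have fl g x : Num.floor ((Num.floor x)%:~R
    + a `|Num.floor x|%N g (x - (Num.floor x)%:~R)) = Num.floor x.
  apply: floor_def; rewrite intrD.
  by have := in01 `|Num.floor x|%N g _ (fr x); lra.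
split=> [x|g1 g2 x|g x y xy].
- by rewrite line_action1// addrC subrK.
- by rewrite fl [X in a _ g1 X]addrAC subrr add0r line_actionM.
- have := @le_floor _ _ _ (ltW xy); rewrite le_eqVlt => /orP[/eqP <-|fxy].
    by rewrite ltrD2l line_action_lt// ltrD2r.
  have {}fxy : (Num.floor x)%:~R + 1 <= (Num.floor y)%:~R :> R.
    by rewrite -[1]/(1%:~R) -intrD ler_int lezD1.
  have := in01 `|Num.floor x|%N g _ (fr x).
  by have := in01 `|Num.floor y|%N g _ (fr y); lra.
Qed.

Lemma line_action_shrink a :
  line_action a -> (forall g, a g 0 = 0) ->
  line_action (fun g => shrink (a g)).
Proof.
rewrite /shrink; move=> aP a0.
pose k x : R := x / (1 - x); pose h x : R := x / (1 + x).
have kge x : 0 <= x < 1 -> 0 <= k x by move=> ?; rewrite divr_ge0//; lra.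
have hin x : 0 <= x -> 0 <= h x < 1 by exact: shrink_point_itv.
have hK x : 0 <= x -> k (h x) = x by move=> x0; rewrite /k /h; field; lra.
have kK x : 0 <= x < 1 -> h (k x) = x.
  by move=> x0; rewrite /k /h; field; apply/andP; split; lra.
have hlt x y : 0 <= x -> x < y -> h x < h y.
  move=> x0 xy; rewrite /h ltr_pdivrMr; last lra.
  by rewrite mulrAC ltr_pdivlMr; lra.
have klt x y : 0 <= x -> x < y -> y < 1 -> k x < k y.
  move=> x0 xy y1; rewrite /k ltr_pdivrMr; last lra.
  by rewrite mulrAC ltr_pdivlMr; lra.
have age g x : 0 <= x -> 0 <= a g x.
  by move=> x0; rewrite -(a0 g) line_action_le.
have e g x : a g (x / (1 - x)) / (1 + a g (x / (1 - x))) = h (a g (k x)) by [].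
split=> [x|g1 g2 x|g x y xy]; rewrite !e.
- by case: ifPn => // x01; rewrite line_action1// kK.
- case: ifPn => [x01|/negbTE -> //].
  rewrite hin; last exact/age/kge.
  by rewrite hK ?line_actionM//; exact/age/kge.
- case: ifPn => x01; case: ifPn => y01.
  + by apply: hlt; [exact/age/kge|apply: line_action_lt => //; apply: klt; lra].
  + have := hin _ (age g _ (kge _ x01)).
    by move: y01; rewrite negb_and -ltNge -leNgt => /orP; lra.
  + have := hin _ (age g _ (kge _ y01)).
    by move: x01; rewrite negb_and -ltNge -leNgt => /orP; lra.
  + by [].
Qed.

End LineActions.

(** Take the map through (p1, q1) that is affine on either side, with slope [L] on the left and [K]
    on the right. *)
Lemma three_point_interpolation (R : realType) (p0 p1 p2 q0 q1 q2 : R) :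
  p0 < p1 -> p1 < p2 -> q0 < q1 -> q1 < q2 ->
  exists h k : R -> R, [/\ cancel h k, cancel k h,
    {homo h : x y / x < y}, {homo k : x y / x < y} &
    [/\ h p0 = q0, h p1 = q1 & h p2 = q2]].
Proof.
move=> p01 p12 q01 q12.
pose K : R := (q2 - q1) / (p2 - p1); pose L : R := (q1 - q0) / (p1 - p0).
have K0 : 0 < K by rewrite divr_gt0//; lra.
have L0 : 0 < L by rewrite divr_gt0//; lra.
pose h x := q1 + (x - p1) * (if x <= p1 then L else K).
pose k x := p1 + (x - q1) / (if x <= q1 then L else K).
have slope_gt0 (t : bool) : 0 < if t then L else K by case: t.
have hq x : (h x <= q1) = (x <= p1).
  by rewrite /h gerDl pmulr_lle0// subr_le0.
have kp x : (k x <= p1) = (x <= q1).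
  by rewrite /k gerDl pmulr_lle0 ?invr_gt0// subr_le0.
have hK : cancel h k.
  by move=> x; rewrite /k hq /h; case: ifP => _; field; lra.
have kK : cancel k h.
  by move=> x; rewrite /h kp /k; case: ifP => _; field; lra.
have hlt : {homo h : x y / x < y}.
  move=> x y xy; have := hq x; have := hq y; rewrite /h.
  case: (leP x p1) => xp; case: (leP y p1) => yp hy hx.
  - by rewrite ltrD2l ltr_pM2r//; lra.
  - by apply: le_lt_trans (_ : q1 < _); rewrite ?hx// ltNge hy.
  - by lra.
  - by rewrite ltrD2l ltr_pM2r//; lra.
exists h, k; split=> //.
  move=> x y xy; rewrite ltNge le_eqVlt; apply/negP => /orP[/eqP kxy|/hlt].
    by move: xy; rewrite -(kK x) -(kK y) kxy ltxx.
  by rewrite !kK ltNge (ltW xy).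
split; rewrite /h.
- by rewrite (ltW p01) /L; field; lra.
- by rewrite subrr mul0r addr0.
- by rewrite leNgt p12 /= /K; field; lra.
Qed.

(** * Reduced words acting on the line *)

Section ReducedWords.
Variables (R : realType) (J : Type) (G : J -> groupType).
Implicit Types (a : forall j, G j -> R -> R) (u v w : fpword G) (x : R).

Definition word_eval a w x : R :=
  foldr (fun l => a (projT1 l) (projT2 l)) x w.

Lemma word_eval_cat a u v x :
  word_eval a (u ++ v) x = word_eval a u (word_eval a v x).
Proof. exact: foldr_cat. Qed.

Lemma word_eval_fpequiv a u v : (forall j, line_action (a j)) ->
  fpequiv u v -> word_eval a u =1 word_eval a v.
Proof.
move=> aP; elim=> {u v} [u|u v _ uv|u v w _ uv _ vw|u v j|u v j g h] x //.
- by rewrite uv vw.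
- by rewrite !word_eval_cat /= line_action1.
- by rewrite !word_eval_cat /= line_actionM.
Qed.

Lemma freeprod_line_action a : (forall j, line_action (a j)) ->
  line_action (fun z : freeprod G => word_eval a (repr z)).
Proof.
move=> aP; split=> [x|z t x|z x y xy].
- by rewrite (word_eval_fpequiv aP (repr_fpclass _)).
- by rewrite (word_eval_fpequiv aP (repr_fpclass _)) word_eval_cat.
- by elim: (repr z) => [//|[j g] w IH] /=; exact: line_action_lt.
Qed.

Definition starts_in (j : J) w : Prop :=
  if w is l :: _ then projT1 l = j else False.

Fixpoint reduced w : Prop :=
  if w is l :: w' then
    [/\ projT2 l <> 1%g, ~ starts_in (projT1 l) w' & reduced w']
  else True.

(** Prepend a letter to a reduced word: drop it if trivial, merge it with a leading letter of the
    same factor, and if the product is trivial keep the tail, which is already reduced. *)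
Lemma fpequiv_reduced u : exists2 v, reduced v & fpequiv u v.
Proof.
elim: u => [|[j g] u [v vred uv]]; first by exists [::] => //; exact: FpRefl.
have {}uv := fpequiv_catl [:: fpletter g] uv.
have [g1|g1] := pselect (g = 1%g).
  by subst g; exists v => //; apply: FpTrans uv _; exact: (@FpOne _ _ [::]).
have [jv|jv] := pselect (starts_in j v); last by exists (fpletter g :: v).
case: v => [//|[i h] v] in vred uv jv *.
rewrite /= in jv; subst i; case: vred => /= h1 jv vred.
have {}uv := FpTrans uv (@FpMul _ _ [::] v j g h).
have [gh1|gh1] := pselect ((g * h)%g = 1%g).
  exists v => //; apply: FpTrans uv _; rewrite gh1; exact: (@FpOne _ _ [::]).
by exists (fpletter (g * h)%g :: v).
Qed.

(* The orbit of 1 climbs with every letter.  At each stage every factor but   *)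
(* the one of the leading letter is trivial to the right of [c], and [c < y], *)
(* so a new letter from another factor can be made to act on [c, +oo), moving *)
(* the current point [y] past the end [d] of all supports.                    *)
Lemma reduced_word_climbs (b : forall j, G j -> R -> R) (r : R) w :
  (forall j, line_action (b j)) ->
  (forall j g x, r <= `|x| -> b j g x = x) ->
  (forall j g, g <> 1%g -> exists x, x < b j g x) ->
  reduced w ->
  exists a (c d y : R),
    [/\ [/\ 0 <= c, c < y & y < d], forall j, line_action (a j),
        forall j g x, x <= 0 \/ d <= x -> a j g x = x,
        forall j g x, ~ starts_in j w -> c <= x -> a j g x = x &
        (if w is [::] then True else 1 < y) /\
        forall a', (forall j g x, x <= c \/ (starts_in j w /\ x <= d) ->
                     a' j g x = a j g x) ->
          word_eval a' w 1 = y].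
Proof.
move=> bP br bup; elim: w => [_|[j g] w IH /= [/= g1 jw wred]].
  by exists (fun _ _ x => x), 0, 2, 1; split=> //; split; lra.
have [a [c [d [y [[c0 cy yd] aP asupp ac [y1 ay]]]]]] := IH wred.
have [p pq] := bup _ _ g1; set q := b j g p in pq.
have pr : `|p| < r.
  by rewrite ltNge; apply: contraPN pq => /br; rewrite /q => ->; rewrite ltxx.
have := pr; rewrite ltr_norml => /andP[rp rp'].
have qr : q < r by rewrite /q -(br j g r) ?ler_norm// line_action_lt.
(* Conjugation by [h] moves the support, inside [-r, r], to the right of [c], and turns the motion
   of [p] to [q] under [g] into a motion of [y] to [d + 1]. *)
have [h [k [hK kK hlt klt [hr hp hq]]]] :
    exists h k : R -> R, [/\ cancel h k, cancel k h,
      {homo h : x y / x < y}, {homo k : x y / x < y} &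
      [/\ h (- r) = c, h p = y & h q = d + 1]].
  by apply: three_point_interpolation => //; rewrite (lt_trans yd)// ltrDl.
have kc : k c = - r by rewrite -hr hK.
have der : d + 1 < h r by rewrite -hq hlt.
pose bj i g x := h (b i g (k x)).
have bjP i : line_action (bj i) by exact: line_action_conj hK kK hlt klt (bP i).
have bjc i f : bj i f c = c.
  by rewrite /bj kc br ?hr// normrN ler_norm.
(* Only the factor [j] changes, and only beyond [c], where it was trivial because [w] does not start
   in [j]. *)
exists (fun i f x => if (x <= c) || `[< i <> j >] then a i f x else bj i f x).
exists d, (h r), (d + 1); split.
- by split; lra.
- move=> i; have [ij|ij] := asboolP (i <> j).
    by under eq_fun do under eq_fun do rewrite orbT.
  under eq_fun do under eq_fun do rewrite orbF.
  apply: line_action_glue => // f; apply: ac => //.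
  by move/contrapT : ij => ->.
- move=> i f x xs; have [ij|/contrapT ij] := asboolP (i <> j).
    by rewrite orbT asupp//; lra.
  rewrite orbF; case: leP => xc; first by rewrite asupp//; lra.
  rewrite /bj br ?kK//.
  case: xs => [|rx]; first lra.
  apply: le_trans (ler_norm _); rewrite -(hK r).
  by rewrite leNgt; apply/negP => /hlt; rewrite !kK ltNge rx.
- move=> i f x /= ji dx; rewrite ifT; first by rewrite asupp//; right.
  by apply/orP; right; apply/asboolP => ij; apply: ji.
- split; first by case: w y1 {IH jw wred ac ay} => [_|_ _] /=; lra.
  move=> a' a'E; have -> : word_eval a' w 1 = y.
    (* Between [c] and [d], the old orbit depends only on the leading factor of [w], which differs
       from [j] and so is unchanged. *)
    apply: ay => i f x xcd; rewrite a'E; last by left; case: xcd => [|[_]]; lra.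
    case: xcd => [-> //|[iw xd]]; rewrite ifT//; apply/orP; right.
    by apply/asboolP => ij; subst i.
  rewrite a'E; last by right; split=> //; lra.
  rewrite ifF; first by rewrite /bj -hp hK -hq.
  by rewrite leNgt cy; apply/asboolP; case.
Qed.

End ReducedWords.

(** * Passing between line actions and homeomorphisms of [0, 1] *)

Section IntervalHomeomorphisms.
Variable R : realType.
Implicit Types (G : groupType) (x : R).

(** The inverse [a g^-1] is increasing too, so [a g] maps a segment around [x] increasingly onto a
    segment, and such a map is continuous. *)
Lemma line_action_continuous G (a : G -> R -> R) g :
  line_action a -> continuous (a g).
Proof.
move=> aP x; have x1 : x - 1 < x + 1 by lra.
have amono : {in `[x - 1, x + 1] &, {mono a g : y z / y <= z}}.
  by move=> y z _ _; rewrite le_mono// => ? ?; exact: line_action_lt.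
have aK z : a g^-1%g (a g z) = z.
  by have := line_actionKV (g^-1)%g aP z; rewrite invgK.
have asurj : set_surj `[x - 1, x + 1] `[a g (x - 1), a g (x + 1)] (a g).
  move=> y /=; rewrite in_itv/= => /andP[y1 y2].
  exists (a g^-1%g y); last exact: line_actionKV.
  rewrite /= in_itv/=; apply/andP; split.
    by rewrite -(aK (x - 1)) line_action_le.
  by rewrite -(aK (x + 1)) line_action_le.
have /(continuous_within_itvP _ x1)[+ _ _] :=
  segment_inc_surj_continuous amono asurj.
by apply; rewrite in_itv/=; lra.
Qed.

Lemma line_action_unit_itv G (a : G -> R -> R) g x :
  line_action a -> (forall x, x <= 0 -> a g x = x) ->
  (forall x, 1 <= x -> a g x = x) ->
  x \in (`[0, 1]%classic : set R) -> a g x \in (`[0, 1]%classic : set R).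
Proof.
move=> aP a0 a1; rewrite !inE/= !in_itv/= => /andP[x0 x1].
apply/andP; split; first by rewrite -[leLHS](a0 0)// line_action_le.
by rewrite -[leRHS](a1 1)// line_action_le.
Qed.

Lemma line_action_homeoplus G (a : G -> R -> R) :
  line_action a -> (forall g x, x <= 0 -> a g x = x) ->
  (forall g x, 1 <= x -> a g x = x) ->
  exists f : {multiplicative G -> homeoplus R},
    forall g (x : unit_interval R), \val (f g x) = a g (\val x).
Proof.
move=> aP a0 a1.
pose F g (x : unit_interval R) : unit_interval R :=
  exist (fun r => r \in (`[0, 1]%classic : set R)) _
    (line_action_unit_itv aP (a0 g) (a1 g) (valP x)).
have Fc g : continuous (F g).
  apply: (@continuous_comp_initial _ _ _ (\val : unit_interval R -> R)) => x.
  apply: (@continuous_comp _ _ _ (\val : unit_interval R -> R) (a g)).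
    exact: initial_continuous.
  exact: line_action_continuous.
have FK g : cancel (F g^-1%g) (F g).
  by move=> x; apply: val_inj; exact: line_actionKV.
have FP g : orientation_preserving_homeo (F g).
  apply/asboolP; split; last by move=> x y; exact: line_action_lt.
  exists (F g^-1%g); split=> //.
  by have := FK (g^-1)%g; rewrite invgK.
pose f g := HomeoPlus (FP g).
have fM : {morph f : g h / (g * h)%g}.
  move=> g h; apply/val_inj/funext => x; apply: val_inj.
  exact: line_actionM.
pose fm := isMultiplicative.Build G (homeoplus R) f fM.
pose ff : {multiplicative G -> homeoplus R} := HB.pack f fm.
by exists ff.
Qed.

Lemma homeoplus_line_action G :
  countable_homeoplus_group R G ->
  countable [set: G] /\
  exists a : G -> R -> R, [/\ line_action a, forall g x, x <= 0 -> a g x = x,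
    forall g x, 3 <= x -> a g x = x &
    forall g, g <> 1%g -> exists x, a g x <> x].
Proof.
move=> [S [f [_ cS [fS finj _]]]].
have {}finj : injective f by move=> g h; apply: finj; rewrite inE.
have f1 : f 1%g = 1%g by apply: (@mulgI _ (f 1%g)); rewrite -gmulfM !mulg1.
split.
  have [e einj] := countable_injP _ cS.
  apply/countable_injP; exists (e \o f) => g h _ _ /einj efgh.
  by apply/finj/efgh; rewrite inE; exact: fS.
pose E (h : homeoplus R) x : R :=
  if @insub R _ (unit_interval R) x is Some u then \val (h u) else x.
have unitP (u : unit_interval R) : 0 <= \val u <= 1.
  by have := valP u; rewrite inE/= in_itv.
have outP x : x \notin (`[0, 1]%classic : set R) -> x < 0 \/ 1 < x.
  move/negP; rewrite inE/= in_itv/= => /negP.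
  by rewrite negb_and -!ltNge => /orP.
have EP : line_action (fun g => E (f g)).
  split=> [x|g h x|g x y xy]; rewrite /E.
  - by case: insubP => [u _ <-|//]; rewrite f1.
  - case: insubP => [u _ _|nx]; first by rewrite gmulfM valK.
    by case: insubP => // u ux; rewrite ux in nx.
  - have incf := (homeoplusP (f g)).2.
    case: (@insubP R _ (unit_interval R) x) => [u _ ux|];
      case: (@insubP R _ (unit_interval R) y) => [v _ vy|].
    + by apply: incf; rewrite ux vy.
    + by move=> /outP; have := unitP u; have := unitP (f g u); lra.
    + by move=> /outP; have := unitP v; have := unitP (f g v); lra.
    + by [].
have Eout h x : x < 0 \/ 1 < x -> E h x = x.
  by rewrite /E; case: insubP => // u _ <-; have := unitP u; lra.
(* The shift puts the support in [1, 2], strictly inside [0, 3], so only points strictly outside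
   [0, 1] need [Eout]. *)
exists (fun g x => E (f g) (x - 1) + 1); split.
- apply: (@line_action_conj _ _ _ (fun x => x + 1) (fun x => x - 1)) EP.
  + exact: addrK.
  + exact: subrK.
  + by move=> x y; rewrite ltrD2r.
  + by move=> x y; rewrite ltrD2r.
- by move=> g x x0; rewrite Eout ?subrK//; lra.
- by move=> g x x0; rewrite Eout ?subrK//; lra.
- move=> g g1; apply: contrapT => nfix; apply: g1; apply: finj; rewrite f1.
  apply/val_inj/funext => u; apply: val_inj => /=; apply: contrapT => fu.
  apply: nfix; exists (\val u + 1); rewrite addrK /E valK.
  by move=> /addIr.
Qed.

End IntervalHomeomorphisms.

(** * Countability, separation of elements and assembly *)

Lemma countable_freeprod (J : Type) (G : J -> groupType) :
  countable [set: J] -> (forall j, countable [set: G j]) ->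
  countable [set: freeprod G].
Proof.
move=> /countable_injP[e einj] cG.
have {}einj : injective e by move=> i j; apply: einj; rewrite inE.
have /all_sig[k kinj] j : {k : G j -> nat | injective k}.
  apply: cid; have /countable_injP[k kinj] := cG j; exists k => g h.
  by apply: kinj; rewrite inE.
pose code (l : {j : J & G j}) := (e (projT1 l), k _ (projT2 l)).
have codeI : injective code.
  by move=> [i g] [j h] [] /einj ij; subst j => /kinj <-.
apply/countable_injP; exists (fun z => pickle (map code (repr z))) => z t _ _.
by move=> /(pcan_inj pickleK)/(inj_map codeI) zt; rewrite -[z]reprK zt reprK.
Qed.

Lemma freeprod_separated (R : realType) (J : Type) (G : J -> groupType)
    (z : freeprod G) :
  (forall j, countable_homeoplus_group R (G j)) -> z <> 1%g ->
  exists a : freeprod G -> R -> R,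
    [/\ line_action a, forall t x, x <= 0 -> a t x = x,
      forall t x, 1 <= x -> a t x = x & exists x, a z x <> x].
Proof.
move=> GP z1.
have /all_sig[b bP] j : {b : G j -> R -> R | [/\ line_action b,
    forall g x, 3 <= `|x| -> b g x = x &
    forall g, g <> 1%g -> exists x, x < b g x]}.
  apply: cid; have [_ [a [aP a0 a3 af]]] := homeoplus_line_action (GP j).
  exact: line_action_up af.
have [u zu] := fpclass_surj z; have [w wred uw] := fpequiv_reduced u.
have {zu uw}zw : z = fpclass w by rewrite zu; exact: fpclass_eq.
have [] := @reduced_word_climbs R J G b 3 w _ _ _ wred.
- by move=> j; have [] := bP j.
- by move=> j; have [] := bP j.
- by move=> j; have [] := bP j.
move=> a [c [d [y [[c0 cy yd] aP asupp _ [y1 ay]]]]].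
have d0 : 0 < d by apply: lt_trans yd; exact: le_lt_trans cy.
have {}y1 : 1 < y by case: w zw y1 {wred ay} => // zw; case: z1.
pose A := fun t : freeprod G => word_eval a (repr t).
have AP : line_action A by exact: freeprod_line_action.
have Asupp t x : x <= 0 \/ d <= x -> A t x = x.
  by move=> xd; rewrite /A; elim: (repr t) => //= l v ->; exact: asupp.
(* Rescaling takes [0, d] to [0, 1]; the point 1, which [z] sends to [y > 1], becomes [1 / d]. *)
exists (fun t x => A t (x * d) / d); split.
- apply: (@line_action_conj _ _ _ (fun x => x / d) (fun x => x * d)) AP.
  + by apply: divfK; rewrite gt_eqF.
  + by apply: mulfK; rewrite gt_eqF.
  + by move=> x x'; rewrite ltr_pM2r// invr_gt0.
  + by move=> x x'; rewrite ltr_pM2r.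
- move=> t x x0; rewrite Asupp ?mulfK ?gt_eqF//; left.
  by rewrite pmulr_lle0.
- move=> t x x1; rewrite Asupp ?mulfK ?gt_eqF//; right.
  by rewrite ler_peMl// ltW.
- exists (1 / d); rewrite divfK ?gt_eqF// /A zw.
  rewrite (word_eval_fpequiv aP (repr_fpclass _)) ay//.
  move=> /(mulIf (invr_neq0 (lt0r_neq0 d0))) y1E.
  by move: y1; rewrite y1E ltxx.
Qed.

Lemma countable_homeoplus_separated (R : realType) (G : groupType) :
  countable [set: G] ->
  (forall z : G, z <> 1%g -> exists a : G -> R -> R,
    [/\ line_action a, forall t x, x <= 0 -> a t x = x,
      forall t x, 1 <= x -> a t x = x & exists x, a z x <> x]) ->
  countable_homeoplus_group R G.
Proof.
move=> /countable_injP[e einj] Gsep.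
have {}einj : injective e by move=> s t; apply: einj; rewrite inE.
(* As [e] is injective, each index [n] has to separate at most one element; the other indices get
   the trivial action. *)
have /choice[b bP] n : exists b : G -> R -> R,
    [/\ line_action b, forall t x, x <= 0 -> b t x = x,
      forall t x, 1 <= x -> b t x = x &
      forall z, e z = n -> z <> 1%g -> exists x, b z x <> x].
  have [[z [<- z1]]|noz] := pselect (exists z, e z = n /\ z <> 1%g).
    have [b [b1 b2 b3 bz]] := Gsep _ z1.
    by exists b; split=> // t /einj ->.
  exists (fun _ x => x); split=> // z zn z1.
  by case: noz; exists z.
have bP1 n : line_action (b n) by have [] := bP n.
have b0 n t x : x <= 0 -> b n t x = x by have [_ + _ _] := bP n; exact.
have b1 n t x : 1 <= x -> b n t x = x by have [_ _ + _] := bP n; exact.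
pose B t := spread (b^~ t).
have BP : line_action B by exact: line_action_spread.
have B0 t : B t 0 = 0 by rewrite /B /spread floor0 subrr b0// addr0.
pose C t := shrink (B t).
have CP : line_action C by exact: line_action_shrink.
have C0 t x : x <= 0 -> C t x = x.
  move=> x0; rewrite /C /shrink; case: ifP => // /andP[x0' _].
  have -> : x = 0 by apply/eqP; rewrite eq_le x0.
  by rewrite mul0r B0 mul0r.
have C1 t x : 1 <= x -> C t x = x.
  by move=> x1; rewrite /C /shrink ltNge x1 andbF.
have [f fE] := line_action_homeoplus CP C0 C1.
have f1 : f 1%g = 1%g by apply: (@mulgI _ (f 1%g)); rewrite -gmulfM !mulg1.
have fker z : f z = 1%g -> z = 1%g.
  move=> fz; apply: contrapT => z1.
  have [_ _ _ /(_ z erefl z1)[x]] := bP (e z); apply.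
  have [x0|x0] := leP x 0; first exact: b0.
  have [x1|x1] := leP 1 x; first exact: b1.
  (* [s] is the copy of [x] in the cell of index [e z], and [p] its image in [0, 1). Since [f z]
     fixes [p], undoing both constructions shows that [b (e z) z] fixes [x]. *)
  pose s : R := (e z)%:R + x; pose p := s / (1 + s).
  have s0 : 0 < s by rewrite ltr_wpDl.
  have Cp : C z p = p.
    have pI : p \in (`[0, 1]%classic : set R).
      rewrite inE/= in_itv/=; have /andP[-> /ltW ->//] : 0 <= p < 1.
      exact/shrink_point_itv/ltW.
    have := fE z (exist (fun r => r \in (`[0, 1]%classic : set R)) p pI).
    by rewrite fz.
  have Bs : B z s = s.
    apply: (shrink_fixed _ _ Cp); rewrite ?(ltW s0)//.
    by rewrite -(B0 z) line_action_le// ltW.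
  have fs : Num.floor s = (e z)%:Z.
    by apply: floor_def; rewrite intrD ler_wpDr ?ltrD2l// ltW.
  move: Bs; rewrite /B /spread fs /= {2}/s => /addrI.
  by rewrite /s [_ + x]addrC addrK.
have finj : injective f.
  move=> s t fst; apply: (@mulIg _ t^-1%g); rewrite mulgV; apply: fker.
  by rewrite gmulfM fst -gmulfM mulgV.
exists (fun h => `[< exists z, f z = h >]), f; split.
- split=> [|_ _ /asboolP[s <-] /asboolP[t <-]]; apply/asboolP.
    by exists 1%g.
  exists (s / t)%g; apply: (@mulIg _ (f t)).
  by rewrite -gmulfM !mulgVK.
- apply/countable_injP.
  have /choice[k kP] h : exists z, (exists z', f z' = h) -> f z = h.
    have [[z zh]|nz] := pselect (exists z, f z = h); first by exists z.
    by exists 1%g.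
  exists (e \o k) => h h'; rewrite !inE/= => /asboolP/kP kh /asboolP/kP kh'.
  by move=> /einj khh'; rewrite -kh khh'.
- split.
  + by move=> z _; apply/asboolP; exists z.
  + by move=> s t _ _; exact: finj.
  + by move=> h /asboolP[z zh]; exists z.
Qed.

Theorem proposition6p1 (R : realType) (J : Type) (G : J -> groupType) :
  countable [set: J] ->
  (forall j, countable_homeoplus_group R (G j)) ->
  countable_homeoplus_group R (freeprod G).
Proof.
move=> cJ GP; apply: countable_homeoplus_separated => [|z].
  by apply: countable_freeprod => // j; have [] := homeoplus_line_action (GP j).
exact: freeprod_separated.
Qed.
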